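(* Let $\alpha, A, B$ be real constants, let $a,b,c,d$ be nonzero real numbers, and let $(x_n)_{n=-3}^\infty$ be the (well-defined) solution of $$x_{n+1}=\frac{\alpha x_{n-3}}{A+B x_{n-1}x_{n-3}},\qquad n\ge 0,$$ with initial data $x_{-3}=d$, $x_{-2}=c$, $x_{-1}=b$, $x_0=a$. Then, for all $n\geq 2$, $$x_{4n-3}=\frac{d\,\alpha^n\prod_{p=0}^{n-2}\Big(A^{2p+2}+B bd\sum_{i=0}^{2p+1}A^i\alpha^{2p+1-i}\Big)}{\prod_{p=0}^{n-1}\Big(A^{2p+1}+B bd\sum_{i=0}^{2p}A^i\alpha^{2p-i}\Big)},$$ $$x_{4n-2}=\frac{c\,\alpha^n\prod_{p=0}^{n-2}\Big(A^{2p+2}+B ac\sum_{i=0}^{2p+1}A^i\alpha^{2p+1-i}\Big)}{\prod_{p=0}^{n-1}\Big(A^{2p+1}+B ac\sum_{i=0}^{2p}A^i\alpha^{2p-i}\Big)},$$ $$x_{4n-1}=\frac{b\,\alpha^n\prod_{p=0}^{n-1}\Big(A^{2p+1}+B bd\sum_{i=0}^{2p}A^i\alpha^{2p-i}\Big)}{\prod_{p=0}^{n-1}\Big(A^{2p+2}+B bd\sum_{i=0}^{2p+1}A^i\alpha^{2p+1-i}\Big)},$$ $$x_{4n}=\frac{a\,\alpha^n\prod_{p=0}^{n-1}\Big(A^{2p+1}+B ac\sum_{i=0}^{2p}A^i\alpha^{2p-i}\Big)}{\prod_{p=0}^{n-1}\Big(A^{2p+2}+B ac\sum_{i=0}^{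2p+1}A^i\alpha^{2p+1-i}\Big)}.$$
   Context: A solution is a real sequence $(x_n)_{n\ge -3}$ with the given initial data satisfying the recurrence for all $n\ge 0$; it is understood to be well defined, i.e. the denominator $A+Bx_{n-1}x_{n-3}$ is nonzero for every $n\ge 0$. The convention $0^0=1$ is used. *)

(* Defs.v *)
From mathcomp Require Import all_boot all_order all_algebra.
From mathcomp Require Import reals.

Set Implicit Arguments.
Unset Strict Implicit.
Unset Printing Implicit Defensive.

Import Order.TTheory GRing.Theory Num.Theory.
Local Open Scope ring_scope.

(* Division is total in MathComp ([u / 0 = 0]), so an equation between [x] and
   a fraction has to state separately that the fraction is meaningful. *)
Definition is_frac (R : realType) (x num den : R) : Prop :=
  den != 0 /\ x = num / den.

(* A sequence (x_n)_{n >= -3} is a function on [int]; its values at indices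
   below -3 are unconstrained and never used. *)
Definition is_solution (R : realType) (alpha A B a b c d : R) (x : int -> R) :
    Prop :=
  [/\ x (- 3) = d, x (- 2) = c, x (- 1) = b, x 0 = a
    & forall n : nat,
        is_frac (x (n%:Z + 1))
          (alpha * x (n%:Z - 3))
          (A + B * x (n%:Z - 1) * x (n%:Z - 3))].

(* A^(m+1) + B t \sum_(i=0)^m A^i alpha^(m-i), with 0^0 = 1 *)
Definition factor (R : realType) (alpha A B t : R) (m : nat) : R :=
  A ^+ m.+1 + B * t * \sum_(0 <= i < m.+1) A ^+ i * alpha ^+ (m - i).

(* Main.v *)
(* The subsequences y_k = x_(2k-3) and y_k = x_(2k-2) both satisfy
   y_(k+2) = alpha y_k / (A + B y_(k+1) y_k).  With t = y_1 y_0, F_k = factor k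
   and F_(-1) = 1, the product y_(k+1) y_k equals alpha^k t / F_(k-1), because
   A F_(k-1) + B t alpha^k = F_k makes A + B y_(k+1) y_k equal to F_k / F_(k-1).
   So all F_k are nonzero, y_(k+2) = alpha y_k F_(k-1) / F_k, and the claimed
   formulas follow by telescoping along even and odd k. *)

Require Import Defs.
From mathcomp Require Import all_boot all_order all_algebra.
From mathcomp Require Import reals ring zify.

Set Implicit Arguments.
Unset Strict Implicit.
Unset Printing Implicit Defensive.

Import Order.TTheory GRing.Theory Num.Theory.
Local Open Scope ring_scope.

Lemma factor0 (R : realType) (alpha A B t : R) :
  factor alpha A B t 0 = A + B * t.
Proof. by rewrite /factor big_nat1 !expr0 expr1 !mulr1. Qed.

(** The [i = 0] term of the sum supplies the pure power of [alpha]; every other term contains a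
    factor [A], and pulling it out leaves the previous sum. *)
Lemma factorS (R : realType) (alpha A B t : R) (m : nat) :
  factor alpha A B t m.+1 = A * factor alpha A B t m + B * t * alpha ^+ m.+1.
Proof.
rewrite /factor big_nat_recl // expr0 mul1r subn0.
have -> : \sum_(0 <= i < m.+1) A ^+ i.+1 * alpha ^+ (m.+1 - i.+1) =
          A * \sum_(0 <= i < m.+1) A ^+ i * alpha ^+ (m - i).
  by rewrite mulr_sumr; apply: eq_bigr => i _; rewrite subSS exprS mulrA.
rewrite [A ^+ m.+2]exprS; ring.
Qed.

Section SecondOrderRecurrence.
Variables (R : realType) (alpha A B : R) (y : nat -> R).
Hypothesis y_rec : forall k : nat,
  is_frac (y k.+2) (alpha * y k) (A + B * y k.+1 * y k).

Let F := factor alpha A B (y 1%N * y 0%N).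

Lemma recurrence_mul k : y k.+2 * (A + B * y k.+1 * y k) = alpha * y k.
Proof. by have [den0 ->] := y_rec k; rewrite divfK. Qed.

(** The two claims need a joint induction: the product formula at [k] identifies [F k.+1] as [F k]
    times a denominator of the recurrence, which gives nonvanishing at [k.+1]. *)
Lemma recurrence_factor k :
  F k != 0 /\ y k.+2 * y k.+1 * F k = alpha ^+ k.+1 * (y 1%N * y 0%N).
Proof.
elim: k => [|k [Fk0 IH]].
  have := recurrence_mul 0; have [den0 _] := y_rec 0.
  rewrite /F factor0 mulrA expr1 => E; split=> //.
  by rewrite mulrAC E; ring.
have FS : F k.+1 = F k * (A + B * y k.+2 * y k.+1).
  rewrite /F factorS -/F -[B * _ * _]mulrA [_ * alpha ^+ _]mulrC -IH; ring.
have [den0 _] := y_rec k.+1; rewrite FS; split; first by rewrite mulf_neq0.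
(* Regrouped so that [recurrence_mul] absorbs the denominator and [y k.+2 * F k] is left for the
   induction hypothesis. *)
have -> : y k.+3 * y k.+2 * (F k * (A + B * y k.+2 * y k.+1)) =
          y k.+3 * (A + B * y k.+2 * y k.+1) * (y k.+2 * F k) by ring.
rewrite recurrence_mul [alpha ^+ k.+2]exprS -[RHS]mulrA -IH; ring.
Qed.

Lemma factor_recurrence_neq0 k : F k != 0.
Proof. by have [] := recurrence_factor k. Qed.

(** The initial case of [recurrence_step], separate because [factor] has no index -1; the missing
    factor is 1. *)
Lemma recurrence_step0 : y 2%N * F 0 = alpha * y 0%N.
Proof. by rewrite /F factor0 mulrA recurrence_mul. Qed.

Lemma recurrence_step k : y k.+3 * F k.+1 = alpha * y k.+1 * F k.
Proof.
have [_ E] := recurrence_factor k.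
rewrite -recurrence_mul /F factorS -/F -[B * _ * _]mulrA [_ * alpha ^+ _]mulrC.
rewrite -E; ring.
Qed.

(** Going from [y 0] to [y 2] only puts [F 0] below; each later double step contributes one factor
    above and one below. Hence the upper product is one factor shorter. *)
Lemma recurrence_even n : (0 < n)%N ->
  is_frac (y (2 * n)) (y 0%N * alpha ^+ n * \prod_(0 <= p < n.-1) F (2 * p + 1))
    (\prod_(0 <= p < n) F (2 * p)).
Proof.
case: n => // n _; have prod0 m : \prod_(0 <= p < m) F (2 * p) != 0.
  by rewrite prodf_seq_neq0; apply/allP => p _; exact: factor_recurrence_neq0.
(* The induction runs on the cross-multiplied identity, free of division. *)
split=> //; apply: (canRL (mulfK (prod0 _))).
elim: n => [|n IH] /=.
  by rewrite big_nat1 big_nil expr1 mulr1 muln0 recurrence_step0 mulrC.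
rewrite big_nat_recr //= [in RHS]big_nat_recr //= mulrCA.
have -> : (2 * n.+2 = (2 * n + 1).+3)%N by lia.
have -> : (2 * n.+1 = (2 * n + 1).+1)%N by lia.
rewrite recurrence_step.
have -> : ((2 * n + 1).+1 = 2 * n.+1)%N by lia.
rewrite [alpha ^+ n.+2]exprS.
set P := \prod_(0 <= p < n.+1) _ in IH *.
have -> : P * (alpha * y (2 * n.+1) * F (2 * n + 1)) =
          y (2 * n.+1) * P * (alpha * F (2 * n + 1)) by ring.
rewrite IH /=; ring.
Qed.

(** From [y 1] on, every double step is an instance of [recurrence_step], so the two products have
    equal length. *)
Lemma recurrence_odd n :
  is_frac (y (2 * n).+1) (y 1%N * alpha ^+ n * \prod_(0 <= p < n) F (2 * p))
    (\prod_(0 <= p < n) F (2 * p + 1)).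
Proof.
have prod0 m : \prod_(0 <= p < m) F (2 * p + 1) != 0.
  by rewrite prodf_seq_neq0; apply/allP => p _; exact: factor_recurrence_neq0.
split=> //; apply: (canRL (mulfK (prod0 _))).
elim: n => [|n IH]; first by rewrite !big_nil expr0 !mulr1.
rewrite big_nat_recr //= [in RHS]big_nat_recr //= mulrCA addn1.
have -> : ((2 * n.+1).+1 = (2 * n).+3)%N by lia.
rewrite recurrence_step [alpha ^+ n.+1]exprS.
set P := \prod_(0 <= p < n) F (2 * p + 1) in IH *.
have -> : P * (alpha * y (2 * n).+1 * F (2 * n)) =
          y (2 * n).+1 * P * (alpha * F (2 * n)) by ring.
rewrite IH; ring.
Qed.

End SecondOrderRecurrence.

Theorem theorem2p1 (R : realType) (alpha A B a b c d : R) (x : int -> R)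
  (ha : a != 0) (hb : b != 0) (hc : c != 0) (hd : d != 0)
  (hx : is_solution alpha A B a b c d x) (n : nat) (hn : (2 <= n)%N) :
  [/\ is_frac (x (4 * n%:Z - 3))
        (d * alpha ^+ n *
           \prod_(0 <= p < n.-1) factor alpha A B (b * d) (2 * p + 1))
        (\prod_(0 <= p < n) factor alpha A B (b * d) (2 * p)),
      is_frac (x (4 * n%:Z - 2))
        (c * alpha ^+ n *
           \prod_(0 <= p < n.-1) factor alpha A B (a * c) (2 * p + 1))
        (\prod_(0 <= p < n) factor alpha A B (a * c) (2 * p)),
      is_frac (x (4 * n%:Z - 1))
        (b * alpha ^+ n *
           \prod_(0 <= p < n) factor alpha A B (b * d) (2 * p))
        (\prod_(0 <= p < n) factor alpha A B (b * d) (2 * p + 1))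
    & is_frac (x (4 * n%:Z))
        (a * alpha ^+ n *
           \prod_(0 <= p < n) factor alpha A B (a * c) (2 * p))
        (\prod_(0 <= p < n) factor alpha A B (a * c) (2 * p + 1))].
Proof.
case: hx => x3 x2 x1 x0 x_rec.
pose y (k : nat) := x (2 * k%:Z - 3); pose z (k : nat) := x (2 * k%:Z - 2).
have y_rec k : is_frac (y k.+2) (alpha * y k) (A + B * y k.+1 * y k).
  (* Even indices of the recurrence for [x] involve only [y]; odd ones, used below, only [z]. *)
  have := x_rec (2 * k)%N; rewrite /y.
  have -> : (2 * k)%N%:Z + 1 = 2 * k.+2%:Z - 3 by lia.
  have -> : (2 * k)%N%:Z - 3 = 2 * k%:Z - 3 by lia.
  by have -> : (2 * k)%N%:Z - 1 = 2 * k.+1%:Z - 3 by lia.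
have z_rec k : is_frac (z k.+2) (alpha * z k) (A + B * z k.+1 * z k).
  have := x_rec (2 * k).+1; rewrite /z.
  have -> : (2 * k).+1%:Z + 1 = 2 * k.+2%:Z - 2 by lia.
  have -> : (2 * k).+1%:Z - 3 = 2 * k%:Z - 2 by lia.
  by have -> : (2 * k).+1%:Z - 1 = 2 * k.+1%:Z - 2 by lia.
have y0 : y 0%N = d by [].
have y1 : y 1%N = b by [].
have z0 : z 0%N = c by [].
have z1 : z 1%N = a by [].
have n_gt0 : (0 < n)%N by lia.
(* Splitting [y] and [z] by parity gives the four residue classes modulo 4. *)
have := recurrence_even y_rec n_gt0; have := recurrence_odd y_rec n.
have := recurrence_even z_rec n_gt0; have := recurrence_odd z_rec n.
rewrite y0 y1 z0 z1 /y /z.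
have -> : 2 * (2 * n)%N%:Z - 3 = 4 * n%:Z - 3 by lia.
have -> : 2 * (2 * n)%N%:Z - 2 = 4 * n%:Z - 2 by lia.
have -> : 2 * (2 * n).+1%:Z - 3 = 4 * n%:Z - 1 by lia.
have -> : 2 * (2 * n).+1%:Z - 2 = 4 * n%:Z by lia.
by split.
Qed.
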